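(* Every nonrecursive c.e. $D$-maximal set $A$ of Type 4, 5, 6, or 7 represents the least finite-one degree inside its many-one degree, i.e. $A\le_{\rm fo}B$ for every set $B\equiv_{\rm m}A$.
   Context: All sets are subsets of $\omega$; $X\subseteq^* Y$ means $X\setminus Y$ is finite. $A\le_{\rm m}B$: there is total computable $f$ with $x\in A\iff f(x)\in B$; $\equiv_{\rm m}$ is mutual $\le_{\rm m}$. $A\le_{\rm fo}B$: there is total computable $g$ with $x\in A\iff g(x)\in B$ and every fibre $g^{-1}(\{y\})$ finite. A noncomputable c.e. set $A$ is $D$-maximal if for every c.e. $W\supseteq A$, either $W\setminus A$ is c.e. or there is a computable $R$ with $A\subseteq R\subseteq W$. For a c.e. set $A$, $\mathcal D(A)$ is the family of all c.e. sets disjoint from $A$; a finite or countable family $\{G_i:i\in I\}$ of c.e. sets disjoint from $A$ generates $\mathcal D(A)$ if every c.e. set $D$ disjoint from $A$ satisfies $D\subseteq^*\bigcup_{i\in F}G_i$ for some finite $F\subseteq I$. Generating family types: Type 1: $\{\varnothing\}$. Type 2: $\{R\}$, $R$ infinite computable. Type 3: $\{W\}$, $W$ infinite noncomputable c.e. Type 4: $\{R_0,R_1,\dots\}$, the $R_i$ infinite pairwise disjoint computable sets. Type 5: $\{D_0,R_0,R_1,\dots\}$, $D_0$ noncomputable c.e., the $R_i$ computable, all sets infinite and pairwise disjoint. Type 6: $\{D_0,D_1,\dots\}$, the $D_i$ infinite pairwise disjoint noncomputable c.e. sets. Type 7: $\{D_0,R_0,R_1,\dots\}$, $D_0$ noncomputable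 c.e., the $R_i$ infinite pairwise disjoint computable sets, and $D_0\cap R_i\neq\varnothing$ for infinitely many $i$. A c.e. set $A$ is of Type $n$ if $\mathcal D(A)$ has a generating family of Type $n$ and none of Type $m$ for any $m<n$. *)

(* Defs.v *)
From mathcomp Require Import all_boot.
From mathcomp Require Import boolp classical_sets functions cardinality.

Set Implicit Arguments.
Unset Strict Implicit.
Unset Printing Implicit Defensive.

Local Open Scope classical_set_scope.

(* Kleene's partial recursive functions of arity k, as terms with a big-step
   semantics. [Comp f g] substitutes the m functions [g i] into f; [Prec f g]
   recurses on the first argument, with step g(n, value at n, parameters);
   [Mu f] is unbounded search for a zero in the first argument. *)
Inductive recfun : nat -> Type :=
| Zero : recfun 0
| Succ : recfun 1
| Proj k (i : 'I_k) : recfun k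
| Comp k m (f : recfun m) (g : 'I_m -> recfun k) : recfun k
| Prec k (f : recfun k) (g : recfun k.+2) : recfun k.+1
| Mu k (f : recfun k.+1) : recfun k.

(* [eval f v y]: f converges on v, with value y. In [eval_mu], the [w i] witness
   that f converges to a nonzero value at every i below the zero found. *)
Inductive eval : forall k, recfun k -> k.-tuple nat -> nat -> Prop :=
| eval_zero (v : 0.-tuple nat) : eval Zero v 0
| eval_succ (v : 1.-tuple nat) : eval Succ v (tnth v ord0).+1
| eval_proj k (i : 'I_k) (v : k.-tuple nat) : eval (Proj i) v (tnth v i)
| eval_comp k m (f : recfun m) (g : 'I_m -> recfun k)
    (v : k.-tuple nat) (w : m.-tuple nat) y :
    (forall i, eval (g i) v (tnth w i)) -> eval f w y -> eval (Comp f g) v y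
| eval_prec0 k (f : recfun k) (g : recfun k.+2) (v : k.-tuple nat) y :
    eval f v y -> eval (Prec f g) [tuple of 0 :: v] y
| eval_precS k (f : recfun k) (g : recfun k.+2) (v : k.-tuple nat) n z y :
    eval (Prec f g) [tuple of n :: v] z ->
    eval g [tuple of n :: z :: v] y ->
    eval (Prec f g) [tuple of n.+1 :: v] y
| eval_mu k (f : recfun k.+1) (v : k.-tuple nat) n (w : nat -> nat) :
    (forall i, i < n -> eval f [tuple of i :: v] (w i).+1) ->
    eval f [tuple of n :: v] 0 ->
    eval (Mu f) v n.

Definition computable_fun (f : nat -> nat) : Prop :=
  exists c : recfun 1, forall x, eval c [tuple x] (f x).

(* The characteristic function of R is computable. *)
Definition computable_set (R : set nat) : Prop :=
  computable_fun (fun x => nat_of_bool `[< R x >]).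

Definition ce (W : set nat) : Prop :=
  W = set0 \/ exists2 f, computable_fun f & W = range f.

Definition almost_subset (X Y : set nat) : Prop := finite_set (X `\` Y).

Definition m_reducible (A B : set nat) : Prop :=
  exists2 f, computable_fun f & forall x, A x <-> B (f x).

Definition m_equivalent (A B : set nat) : Prop :=
  m_reducible A B /\ m_reducible B A.

Definition fo_reducible (A B : set nat) : Prop :=
  exists g, [/\ computable_fun g,
    (forall x, A x <-> B (g x)) &
    (forall y, finite_set (g @^-1` [set y]))].

Definition D_maximal (A : set nat) : Prop :=
  [/\ ce A, ~ computable_set A &
    forall W, ce W -> A `<=` W ->
      ce (W `\` A) \/ exists R, [/\ computable_set R, A `<=` R & R `<=` W]].

(* The family of all c.e. sets disjoint from A. *)
Definition calD (A : set nat) : set (set nat) :=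
  [set D | ce D /\ D `&` A = set0].

Definition generates (A : set nat) (G : set (set nat)) : Prop :=
  [/\ countable G, G `<=` calD A &
    forall D, calD A D ->
      exists F : set (set nat), [/\ finite_set F, F `<=` G &
        almost_subset D (\bigcup_(X in F) X)]].

Definition noncomputable_ce (W : set nat) : Prop := ce W /\ ~ computable_set W.

(* Infinite pairwise disjoint sequences of sets; infiniteness makes the
   sequence injective, so its range is an infinite family. *)
Definition infinite_disjoint (R : nat -> set nat) : Prop :=
  (forall i, infinite_set (R i)) /\ trivIset setT R.

(* Sequences are not required to be uniformly computable or uniformly c.e. *)
Definition family_type (n : nat) (G : set (set nat)) : Prop :=
  match n with
  | 1 => G = [set set0]
  | 2 => exists R, [/\ computable_set R, infinite_set R & G = [set R]]
  | 3 => exists W, [/\ noncomputable_ce W, infinite_set W & G = [set W]]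
  | 4 => exists R : nat -> set nat,
      [/\ forall i, computable_set (R i), infinite_disjoint R & G = range R]
  | 5 => exists (D0 : set nat) (R : nat -> set nat),
      [/\ noncomputable_ce D0 /\ infinite_set D0,
          forall i, computable_set (R i), infinite_disjoint R,
          forall i, D0 `&` R i = set0 & G = D0 |` range R]
  | 6 => exists D : nat -> set nat,
      [/\ forall i, noncomputable_ce (D i), infinite_disjoint D & G = range D]
  | 7 => exists (D0 : set nat) (R : nat -> set nat),
      [/\ noncomputable_ce D0,
          forall i, computable_set (R i), infinite_disjoint R,
          infinite_set [set i | D0 `&` R i !=set0] & G = D0 |` range R]
  | _ => False
  end.

Definition has_family (n : nat) (A : set nat) : Prop :=
  exists2 G, family_type n G & generates A G.

Definition of_type (n : nat) (A : set nat) : Prop :=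
  has_family n A /\ forall m, m < n -> ~ has_family m A.

(* Main.v *)
Require Import Defs.
From mathcomp Require Import all_boot.
From mathcomp Require Import boolp classical_sets functions cardinality.

Local Open Scope classical_set_scope.

(* Let f m-reduce A to B, let T be the set of the x with f(x) not in
   {f(0), ..., f(x-1)}, and let E be its complement. D-maximality applied to the
   union of A and E makes E \ A c.e., since otherwise A would be computable: x is
   in A iff the least x' with f(x') = f(x), which lies in T, is. If every c.e. D
   disjoint from A met T in a finite set, then {E \ A} would generate D(A), so A
   would be of type at most 3. So fix D meeting T in an infinite set; A meets T in
   an infinite set too, as A is not computable. Hence there is a computable u with
   u(x) >= x, u(x) in T, and x in A iff u(x) in A: take u(x) = x on T, and on E,
   where membership in A is decidable, search for u(x) in A or in D. As f is
   injective on T, the composite of u and f is a finite-one reduction. *)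

(** * Total computable functions of several variables *)

(** Stated for every arity, so that closure under composition and recursion can be proved once and
    then specialised to [computable_fun]. *)
Definition computable {k} (F : k.-tuple nat -> nat) : Prop :=
  exists c : recfun k, forall v, eval c v (F v).

Definition computable2 (h : nat -> nat -> nat) : Prop :=
  computable (fun v : 2.-tuple nat => h (tnth v ord0) (tnth v ord_max)).

Lemma computable_ext {k} (F G : k.-tuple nat -> nat) :
  F =1 G -> computable F -> computable G.
Proof. by move=> FG [c cF]; exists c => v; rewrite -FG. Qed.

Lemma computable_funP (f : nat -> nat) :
  computable_fun f <-> computable (fun v : 1.-tuple nat => f (tnth v ord0)).
Proof.
split=> -[c cf]; exists c; last by move=> x; apply: (cf [tuple x]).
move=> v; rewrite [X in eval c X](_ : v = [tuple tnth v ord0]) //.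
by case/tupleP: v => x v; rewrite (tuple0 v); apply: val_inj.
Qed.

Lemma computable_proj {k} (i : 'I_k) : computable (fun v => tnth v i).
Proof. by exists (Proj i) => v; constructor. Qed.

Lemma computable_comp {k m} (F : m.-tuple nat -> nat)
    (G : 'I_m -> k.-tuple nat -> nat) :
  computable F -> (forall i, computable (G i)) ->
  computable (fun v => F [tuple G i v | i < m]).
Proof.
move=> [c cF] /choice[d dG]; exists (Comp c d) => v.
by apply: eval_comp (cF _) => i; rewrite tnth_mktuple.
Qed.

Lemma computable_app1 {k} (h : nat -> nat) (F : k.-tuple nat -> nat) :
  computable_fun h -> computable F -> computable (fun v => h (F v)).
Proof.
move=> /computable_funP ch cF.
apply: computable_ext (computable_comp _ (fun=> F) ch (fun=> cF)) => v /=.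
by rewrite tnth_mktuple.
Qed.

Lemma computable_app2 {k} (h : nat -> nat -> nat) (F G : k.-tuple nat -> nat) :
  computable2 h -> computable F -> computable G ->
  computable (fun v => h (F v) (G v)).
Proof.
move=> ch cF cG.
apply: computable_ext (computable_comp _
  (fun i : 'I_2 => if i == ord0 then F else G) ch _) => [v|i] /=.
  by rewrite !tnth_mktuple.
by case: ifP.
Qed.

Lemma computable_succ : computable_fun succn.
Proof. by exists Succ => x; apply: (eval_succ [tuple x]). Qed.

(** [Zero] has arity 0; composing it with the empty family of functions raises the arity to [k], and
    successors do the rest. *)
Lemma computable_const {k} n : computable (fun _ : k.-tuple nat => n).
Proof.
elim: n => [|n IHn]; last exact: computable_app1 computable_succ IHn.
have c0 : computable (fun _ : 0.-tuple nat => 0).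
  by exists Zero => v; constructor.
by apply: (computable_comp _ (fun (i : 'I_0) (_ : k.-tuple nat) => 0) c0) => -[].
Qed.

(** Any Rocq function [h] obeying the recursion equations is covered, however it was defined. *)
Lemma computable_prec {k} (F : k.-tuple nat -> nat) (G : k.+2.-tuple nat -> nat)
    (h : nat -> k.-tuple nat -> nat) :
  computable F -> computable G ->
  (forall v, h 0 v = F v) ->
  (forall n v, h n.+1 v = G [tuple of n :: h n v :: v]) ->
  computable (fun v : k.+1.-tuple nat => h (thead v) (behead_tuple v)).
Proof.
move=> [c cF] [d dG] h0 hS; exists (Prec c d) => v.
rewrite [X in eval _ X](tuple_eta v).
elim: (thead v) => [|n IHn]; first by rewrite h0; apply: eval_prec0.
by apply: eval_precS IHn _; rewrite hS.
Qed.

Lemma computable_prec1 (a : nat) (G : 2.-tuple nat -> nat) (h : nat -> nat) :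
  computable G -> h 0 = a -> (forall n, h n.+1 = G [tuple n; h n]) ->
  computable_fun h.
Proof.
move=> cG h0 hS; apply/computable_funP.
apply: computable_ext (computable_prec (fun=> a) G (fun n _ => h n)
  (computable_const a) cG _ _) => // n v.
by rewrite hS (tuple0 v); congr G; apply: val_inj.
Qed.

Lemma computable_prec2 (F : nat -> nat) (G : 3.-tuple nat -> nat)
    (h : nat -> nat -> nat) :
  computable_fun F -> computable G ->
  (forall x, h 0 x = F x) -> (forall n x, h n.+1 x = G [tuple n; h n x; x]) ->
  computable2 h.
Proof.
move=> /computable_funP cF cG h0 hS.
apply: computable_ext (computable_prec _ G (fun n v => h n (tnth v ord0))
  cF cG _ _) => [v|v|n v] /=.
- case/tupleP: v => x v; case/tupleP: v => y v.
  by rewrite (tuple0 v) !(tnth_nth 0).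
- by rewrite h0.
- case/tupleP: v => x v; rewrite (tuple0 v) hS.
  by congr G; apply: val_inj.
Qed.

(** * Arithmetic, Boolean operations and unbounded search *)

Lemma computable_pred : computable_fun predn.
Proof. exact: (computable_prec1 0 _ _ (computable_proj ord0)). Qed.

Lemma computable_id : computable_fun id.
Proof. exact/computable_funP/computable_proj. Qed.

(** Recursion runs on the first argument, while truncated subtraction recurses on its second. *)
Lemma computable2C (h : nat -> nat -> nat) :
  computable2 (fun x y => h y x) -> computable2 h.
Proof. by move=> ch; apply: (computable_app2 _ _ _ ch); apply: computable_proj. Qed.

Lemma computable_addn : computable2 addn.
Proof.
apply: (computable_prec2 id (fun v => (tnth v (Ordinal (isT : 1 < 3))).+1)) => //.
  exact: computable_id.
by apply: computable_app1; [apply: computable_succ | apply: computable_proj].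
Qed.

Lemma computable_subn : computable2 subn.
Proof.
apply: computable2C.
apply: (computable_prec2 id (fun v => (tnth v (Ordinal (isT : 1 < 3))).-1)).
- exact: computable_id.
- by apply: computable_app1; [apply: computable_pred | apply: computable_proj].
- exact: subn0.
- by move=> n x; rewrite subnS.
Qed.

Lemma computable_muln : computable2 muln.
Proof.
apply: (computable_prec2 (fun=> 0)
  (fun v => tnth v ord_max + tnth v (Ordinal (isT : 1 < 3)))) => //.
- exact/computable_funP/computable_const.
- by apply: computable_app2; [apply: computable_addn | |]; apply: computable_proj.
Qed.

Lemma computable_negb {k} (P : k.-tuple nat -> bool) :
  computable (fun v => P v : nat) -> computable (fun v => ~~ P v : nat).
Proof.
move=> cP; apply: computable_ext (computable_app2 _ _ _ computable_subn
  (computable_const 1) cP) => v.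
by case: (P v).
Qed.

Lemma computable_andb {k} (P Q : k.-tuple nat -> bool) :
  computable (fun v => P v : nat) -> computable (fun v => Q v : nat) ->
  computable (fun v => P v && Q v : nat).
Proof.
move=> cP cQ; apply: computable_ext (computable_app2 _ _ _ computable_muln cP cQ).
by move=> v; case: (P v); case: (Q v).
Qed.

Lemma computable_orb {k} (P Q : k.-tuple nat -> bool) :
  computable (fun v => P v : nat) -> computable (fun v => Q v : nat) ->
  computable (fun v => P v || Q v : nat).
Proof.
move=> /computable_negb cP /computable_negb cQ.
apply: computable_ext (computable_negb _ (computable_andb _ _ cP cQ)) => v.
by rewrite negb_and !negbK.
Qed.

(** The truth value of [a <= b] is [1 - (a - b)] with truncated subtraction. *)
Lemma computable_leq {k} (F G : k.-tuple nat -> nat) :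
  computable F -> computable G -> computable (fun v => F v <= G v : nat).
Proof.
move=> cF cG; apply: computable_ext (computable_app2 _ _ _ computable_subn
  (computable_const 1) (computable_app2 _ _ _ computable_subn cF cG)) => v.
by rewrite /leq; case: (F v - G v).
Qed.

Lemma computable_eqn {k} (F G : k.-tuple nat -> nat) :
  computable F -> computable G -> computable (fun v => F v == G v : nat).
Proof.
move=> cF cG; apply: computable_ext (computable_andb _ _
  (computable_leq _ _ cF cG) (computable_leq _ _ cG cF)) => v.
by rewrite eqn_leq.
Qed.

Lemma computable_if {k} (P : k.-tuple nat -> bool) (F G : k.-tuple nat -> nat) :
  computable (fun v => P v : nat) -> computable F -> computable G ->
  computable (fun v => if P v then F v else G v).
Proof.
move=> cP cF cG; apply: computable_ext (computable_app2 _ _ _ computable_addn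
  (computable_app2 _ _ _ computable_muln cP cF)
  (computable_app2 _ _ _ computable_muln (computable_negb _ cP) cG)) => v.
by case: (P v); rewrite ?mul1n ?mul0n ?addn0.
Qed.

Lemma computable_search (P : nat -> nat -> bool) :
  computable2 (fun n x => P n x : nat) -> (forall x, exists n, P n x) ->
  exists2 g, computable_fun g &
    forall x, P (g x) x /\ forall n, P n x -> g x <= n.
Proof.
move=> /computable_negb[c cP] exP.
exists (fun x => ex_minn (exP x)); last by move=> x; case: ex_minnP.
exists (Mu c) => x; case: ex_minnP => m Pm mmin.
have cE n : eval c [tuple of n :: [tuple x]] (~~ P n x) by exact: cP [tuple n; x].
(* Below the least solution [m] the value of [~~ P i x] is exactly 1, the successor of the witness
   0. *)
apply: (@eval_mu _ _ _ _ (fun=> 0)) => [i im|]; last by have := cE m; rewrite Pm.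
have := cE i; have [/mmin|_] := boolP (P i x); last by [].
by rewrite leqNgt im.
Qed.

Lemma computable_odd : computable_fun odd.
Proof.
apply: (computable_prec1 0 (fun v => 1 - tnth v ord_max)) => [|//|n /=].
  by apply: computable_app2; [apply: computable_subn | apply: computable_const |
    apply: computable_proj].
by rewrite (tnth_nth 0) /=; case: (odd n).
Qed.

Lemma computable_half : computable_fun half.
Proof.
apply: (computable_prec1 0 (fun v => odd (tnth v ord0) + tnth v ord_max)) => // [|n].
  apply: computable_app2; [exact: computable_addn | | exact: computable_proj].
  by apply: (computable_app1 _ _ computable_odd); apply: computable_proj.
by rewrite !(tnth_nth 0) /= -uphalf_half.
Qed.

(** * Computable and c.e. sets *)

(** Replaces the classical truth value in [computable_set] by a Boolean test. *)
Lemma computable_set_dec (P : pred nat) (R : set nat) :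
  computable_fun (fun x => P x : nat) -> (forall x, R x <-> P x) ->
  computable_set R.
Proof.
move=> cP RP; rewrite /computable_set.
suff -> : (fun x => nat_of_bool `[< R x >]) = (fun x => nat_of_bool (P x)) by [].
by apply: funext => x; congr nat_of_bool; apply/asboolP/idP => /RP.
Qed.

Lemma finite_computable (R : set nat) : finite_set R -> computable_set R.
Proof.
move=> /finite_seqP[s ->]; apply: (computable_set_dec (fun x => x \in s)) => //.
apply/computable_funP; elim: s => [|y s IHs]; first exact: computable_const.
apply: computable_ext (computable_orb (fun v => tnth v ord0 == y) _ _ IHs).
  by move=> v; rewrite inE.
by apply: computable_eqn; [apply: computable_proj | apply: computable_const].
Qed.

Lemma computable_set_preim (R : set nat) (f : nat -> nat) :
  computable_set R -> computable_fun f -> computable_set (f @^-1` R).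
Proof.
move=> cR /computable_funP cf.
by apply/computable_funP/(computable_app1 _ _ cR cf).
Qed.

(* The value 0 of [e] enumerates nothing, which accommodates the empty set. *)
Lemma ce_enum (W : set nat) : ce W ->
  exists2 e, computable_fun e & forall x, W x <-> exists s, e s = x.+1.
Proof.
case=> [->|[f cf ->]].
  by exists (fun=> 0); [exact/computable_funP/computable_const | move=> x; split=> // -[]].
exists (succn \o f) => [|x]; last first.
  by split=> [[s _ <-]|[s [<-]]]; exists s.
apply/computable_funP/(computable_app1 _ _ computable_succ).
exact/computable_funP.
Qed.

Lemma enum_ce (W : set nat) (e : nat -> nat) : computable_fun e ->
  (forall x, W x <-> exists s, e s = x.+1) -> ce W.
Proof.
move=> /computable_funP ce_ We.
have [->|/set0P[w Ww]] := eqVneq W set0; [by left|right].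
(* Stages that enumerate nothing output the fixed element [w] instead. *)
exists (fun s => if e s == 0 then w else (e s).-1).
  apply/computable_funP/computable_if; last 2 first.
  - exact: computable_const.
  - exact: computable_app1 computable_pred ce_.
  by apply: computable_eqn => //; apply: computable_const.
apply/seteqP; split=> [x /We[s es]|_ [s _ <-]]; first by exists s; rewrite ?es.
by case: eqP => // /eqP; rewrite -lt0n => es; apply/We; exists s; rewrite prednK.
Qed.

Lemma ce_setU_dec (W : set nat) (P : pred nat) :
  ce W -> computable_fun (fun x => P x : nat) -> ce (W `|` [set x | P x]).
Proof.
move=> /ce_enum[e ce_ We] cP.
(* Even stages enumerate [W]; stage [2x+1] tests [P x]. *)
pose e' n := if odd n then (if P n./2 then n./2.+1 else 0) else e n./2.
apply: (@enum_ce _ e') => [|x].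
  have c2 : computable (fun v : 1.-tuple nat => (tnth v ord0)./2).
    exact/computable_funP/computable_half.
  apply/computable_funP/computable_if; 
    first exact: (computable_app1 _ _ computable_odd (computable_proj ord0)).
  - apply: computable_if; last exact: computable_const.
      exact: (computable_app1 _ _ cP).
    exact: computable_app1 computable_succ c2.
  - exact: computable_app1 ce_ c2.
split=> [[/We[s es]|Px]|[n]].
- by exists s.*2; rewrite /e' odd_double doubleK.
- by exists x.*2.+1; rewrite /e' /= odd_double uphalf_double Px.
- rewrite /e'; case: (odd n); last by move=> en; left; apply/We; exists n./2.
  by case: ifP => // Pn [<-]; right.
Qed.

Lemma infinite_ge (X : set nat) n : infinite_set X -> exists2 x, X x & n <= x.
Proof.
move=> Xinf; apply: contrapT => Xn; apply: Xinf.
apply: (sub_finite_set _ (finite_II n)) => x Xx /=.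
by rewrite ltnNge; apply/negP => nx; apply: Xn; exists x.
Qed.

(** Infinitude makes the search through an enumeration of [W] total even with the bound [x <= p x],
    which later keeps fibres finite. *)
Lemma infinite_ce_search (W : set nat) (P : pred nat) :
  ce W -> computable_fun (fun x => P x : nat) ->
  infinite_set (W `&` [set x | P x]) ->
  exists2 p, computable_fun p & forall x, [/\ W (p x), P (p x) & x <= p x].
Proof.
case=> [->|[w cw ->]] cP Winf; first by case: Winf; rewrite set0I; exact: finite_set0.
have [||g cg gP] := @computable_search (fun s x => P (w s) && (x <= w s)).
- have cws : computable (fun v : 2.-tuple nat => w (tnth v ord0)).
    by apply: computable_app1 cw _; apply: computable_proj.
  apply: computable_andb; first exact: (computable_app1 _ _ cP).
  by apply: computable_leq => //; apply: computable_proj.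
- move=> x; have [_ [[s _ <-] Pws] xws] := infinite_ge _ x Winf.
  by exists s; rewrite Pws.
exists (w \o g) => [|x].
  apply/computable_funP/(computable_app1 _ _ cw).
  exact/computable_funP.
by have [/andP[Pw xw] _] := gP x; split.
Qed.

(** * Fibres of m-reductions from D-maximal sets *)

Lemma generates_set1 (A V : set nat) : calD A V ->
  (forall D, calD A D -> finite_set (D `\` V)) -> generates A [set V].
Proof.
move=> AV Vgen; split=> [|_ ->//|D /Vgen DV]; first exact: finite_set_countable.
by exists [set V]; split; rewrite /almost_subset ?bigcup_set1.
Qed.

(** The single set [V] gives a family of Type 1, 2 or 3 according as it is finite, infinite
    computable, or infinite noncomputable; in the finite case the empty set generates as well. *)
Lemma low_type (A V : set nat) : calD A V ->
  (forall D, calD A D -> finite_set (D `\` V)) ->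
  exists2 m, m < 4 & has_family m A.
Proof.
move=> AV Vgen; have [Vfin|Vinf] := pselect (finite_set V).
  exists 1 => //; exists [set set0] => //; apply: generates_set1 => [|D AD].
    by split; [left | rewrite set0I].
  rewrite setD0; apply: (@sub_finite_set _ _ (D `\` V `|` V)).
    by move=> x Dx; have [|] := pselect (V x); [right|left].
  by rewrite finite_setU; split; first exact: Vgen.
have [cV|ncV] := pselect (computable_set V).
  by exists 2 => //; exists [set V]; [exists V | exact: generates_set1].
exists 3 => //; exists [set V]; last exact: generates_set1.
by exists V; split=> //; split=> //; case: AV.
Qed.

(** The search for an argument with the value [f x] stops at [x] at the latest. *)
Lemma first_occurrence (f : nat -> nat) : computable_fun f ->
  exists2 r, computable_fun r & forall x,
    f (r x) = f x /\ forall y, f y = f x -> r x <= y.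
Proof.
move=> cf; have [||r cr rP] := @computable_search (fun n x => f n == f x).
- by apply: computable_eqn; apply: (computable_app1 _ _ cf);
    apply: computable_proj.
- by move=> x; exists x.
by exists r => // x; have [/eqP ? rmin] := rP x; split=> // y /eqP/rmin.
Qed.

Theorem theorem5p14 (A : set nat)
  (DmaxA : D_maximal A)
  (typeA : of_type 4 A \/ of_type 5 A \/ of_type 6 A \/ of_type 7 A)
  (B : set nat) (BA : m_equivalent B A) :
  fo_reducible A B.
Proof.
have notlow m : m < 4 -> ~ has_family m A.
  move=> m4; case: typeA => [|[|[|]]] -[_]; apply; first by [].
  - exact: leq_trans m4 _.
  - exact: leq_trans m4 _.
  - exact: leq_trans m4 _.
case: DmaxA => ceA ncA Dmax; case: BA => _ [f cf fAB].
have [r cr rP] := first_occurrence f cf.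
have fr x : f (r x) = f x by case: (rP x).
(* Thus [r] retracts onto its fixed points, which form the set T. *)
have rr x : r (r x) = r x.
  apply/eqP; rewrite eqn_leq (rP _).2 ?fr //= (rP _).2 //.
  by rewrite !fr.
have rA x : A (r x) <-> A x by rewrite !fAB fr.
have cT : computable_fun (fun x => r x == x : nat).
  apply/computable_funP/computable_eqn; last exact: computable_proj.
  exact/computable_funP.
have cE : computable_fun (fun x => r x != x : nat).
  exact/computable_funP/computable_negb/(computable_funP (fun x => r x == x)).
pose E := [set x | r x != x].
(* Were this set finite, hence computable, its preimage under [r], which is [A], would be
   computable. *)
have ATinf : infinite_set (A `&` [set x | r x == x]).
  move=> /finite_computable/(computable_set_preim _ r) /(_ cr) cA; apply: ncA.
  rewrite (_ : A = r @^-1` (A `&` [set x | r x == x])) //.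
  by apply/seteqP; split=> x /=; rewrite rr eqxx rA; [split | case].
have [||V_ce|[R [cR AR RAE]]] := Dmax (A `|` E).
- exact: ce_setU_dec.
- by move=> x Ax; left.
- have {V_ce} ceV : ce (E `\` A).
    rewrite (_ : E `\` A = (A `|` E) `\` A) //.
    by apply/seteqP; split=> x [] => [Ex nAx|[//|Ex] nAx]; split=> //; right.
  have AV : calD A (E `\` A) by split=> //; rewrite setDKI.
  have [D [[ceD DA] DTinf]] : exists D, calD A D /\
      infinite_set (D `&` [set x | r x == x]).
    apply: contrapT => noD; have [D AD|m m4 /notlow] := @low_type _ _ AV; last exact.
    apply: contrapT => DVinf; apply: noD; exists D; split=> // DT; apply: DVinf.
    (* A point of [D] is outside [A], so if it is also outside [E \ A] it lies in T. *)
    apply: sub_finite_set DT => x [Dx nV]; split=> //=; apply: contrapT => /negP Ex.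
    apply: nV; split=> // Ax; have : (D `&` A) x by [].
    by case: AD => _ ->.
  have nDA x : D x -> ~ A x.
    by move=> Dx Ax; have : (D `&` A) x by []; rewrite DA.
  have [p cp pP] := infinite_ce_search _ _ ceA cT ATinf.
  have [q cq qP] := infinite_ce_search _ _ ceD cT DTinf.
  have [a ca aP] := ce_enum _ ceA.
  have [e ce_ eP] := ce_enum _ ceV.
  (* T, [A] and [E \ A] cover all numbers, so the search is total; off T, the stage [m x] reveals
     whether [x] is in [A]. *)
  have [||m cm mP] := @computable_search
      (fun s x => (r x == x) || ((a s == x.+1) || (e s == x.+1))).
  + have cS : computable (fun v : 2.-tuple nat => (tnth v ord_max).+1).
      by apply: computable_app1 computable_succ _; apply: computable_proj.
    apply: computable_orb; last apply: computable_orb.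
    * by apply: (computable_app1 _ _ cT); apply: computable_proj.
    * apply: computable_eqn => //.
      by apply: computable_app1 ca _; apply: computable_proj.
    * apply: computable_eqn => //.
      by apply: computable_app1 ce_ _; apply: computable_proj.
  + move=> x; have [Tx|Ex] := boolP (r x == x); first by exists 0.
    have [/aP[s ax]|nAx] := pselect (A x).
      by exists s; rewrite ax eqxx.
    have /eP[s ex] : (E `\` A) x by [].
    by exists s; rewrite ex eqxx orbT.
  (* On [E], failure of the second test means that [e (m x)] enumerates [x] into [E \ A], so [q x],
     taken from [D], is outside [A] too. *)
  pose u x := if r x == x then x else if a (m x) == x.+1 then p x else q x.
  have cu : computable_fun u.
    apply/computable_funP; apply: computable_if.
    - exact: (computable_app1 _ _ cT (computable_proj ord0)).
    - exact: computable_proj.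
    apply: computable_if; [|exact/computable_funP|exact/computable_funP].
    apply: computable_eqn.
      by apply: (computable_app1 _ _ ca); apply/computable_funP.
    by apply: computable_app1 computable_succ _; apply: computable_proj.
  have uP x : [/\ r (u x) = u x, x <= u x & A x <-> A (u x)].
    rewrite /u; case: ifP => [/eqP //|rx].
    have [px /eqP rp xp] := pP x; have [qx /eqP rq xq] := qP x.
    case: ifP => [/eqP ax|ax]; split=> //.
      by split=> // _; apply/aP; exists (m x).
    have [] := mP x; rewrite rx ax /= => /eqP ex _.
    have [_ nAx] : (E `\` A) x by apply/eP; exists (m x).
    by split=> // /(nDA _ qx).
  exists (f \o u); split=> [|x|y].
  + by apply/computable_funP/(computable_app1 _ _ cf)/computable_funP.
  + by have [_ _ ->] := uP x; apply: fAB.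
  (* A nonempty fibre through [x0] is bounded by [u x0]: if [f (u x) = f (u x0)], then
     [x <= u x = r (u x) <= u x0], as [r] picks the least argument with a given value. *)
  + have [[x0 fx0]|nx] := pselect (exists x0, f (u x0) = y); last first.
      apply: (sub_finite_set _ (finite_set0 nat)) => x /= fx.
      by apply: nx; exists x.
    apply: (sub_finite_set _ (finite_II (u x0).+1)) => x /= fx.
    have [ru xu _] := uP x; rewrite ltnS (leq_trans xu) // -ru.
    by apply: (rP _).2; rewrite fx0.
(* Since [r x] is never in [E], it is in [R] only if it is in [A], so [R] would decide [A] through
   [r]. *)
- case: ncA; rewrite (_ : A = r @^-1` R); first exact: computable_set_preim.
  apply/seteqP; split=> x /=; first by move=> /rA/AR.
  by move=> /RAE[/rA//|]; rewrite /E /= rr eqxx.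
Qed.
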